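(* Let $n_1,n_2,n_3,m\in\mathbb{N}_0$, let $U\subseteq\mathbb{R}^{n_1+n_2}$ be open and non-empty, let $H\in\mathcal{C}^\infty(U)$, and let $J,R\in\mathbb{R}^{(n_1+n_2+n_3)\times(n_1+n_2+n_3)}$ and $B\in\mathbb{R}^{(n_1+n_2+n_3)\times m}$ satisfy $J+J^\top=0$, $R=R^\top$, $R\geq 0$. Then the dynamical system $$\begin{pmatrix}\partial_{z_1}H(z_1,z_2)\\ \tfrac{\mathrm{d}}{\mathrm{d}t}z_2\\ 0\end{pmatrix}=(J-R)\begin{pmatrix}\tfrac{\mathrm{d}}{\mathrm{d}t}z_1\\ \partial_{z_2}H(z_1,z_2)\\ z_3\end{pmatrix}+Bu,\qquad y=B^\top\begin{pmatrix}\tfrac{\mathrm{d}}{\mathrm{d}t}z_1\\ \partial_{z_2}H(z_1,z_2)\\ z_3\end{pmatrix}$$ in the variables $(z_1,z_2,z_3,u,y)$, with $(z_1,z_2)$ taking values in $U$, is equivalent to a port-Hamiltonian system with implicitly defined energy in such a way that $z_3$ is a free co-vector.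
   Context: All vector spaces are real and finite-dimensional; trajectories are smooth functions on an open interval $(t_0,t_1)$. Here $z_i$ takes values in $\mathbb{R}^{n_i}$ and $u,y$ take values in $\mathbb{R}^m$; $\mathbb{R}^k$ and its dual are identified via coordinates. Dirac structure: a subspace $D\leq X\oplus X^*$ which is isotropic and co-isotropic (i.e. $D=D^\perp$) with respect to $\langle\!\langle (f,e),(f',e')\rangle\!\rangle:=\langle e,f'\rangle+\langle e',f\rangle$. Lagrangian subspace: a subspace $L\leq X\oplus X^*$ which is isotropic and co-isotropic with respect to $\Omega_{\mathrm{can}}((f,e),(f',e')):=\langle e,f'\rangle-\langle e',f\rangle$. It is non-negative if $\langle e,f\rangle\ge 0$ for all $(f,e)\in L$. Lagrangian submanifold in an open set $U'\subseteq X$: a smooth submanifold $\mathcal{L}\subseteq U'\times X^*$ each of whose tangent spaces is a Lagrangian subspace of $X\oplus X^*$. Port-Hamiltonian system: given spaces $X,X_r,X_p$, an open set $U'\subseteq X$, a Dirac structure $\mathcal{D}\leq(X\oplus X_r\oplus X_p)\oplus(X^*\oplus X_r^*\oplus X_p^* )$, a non-negative Lagrangian subspace $L_r\leq X_r\oplus X_r^*$ and a Lagrangian submanifold $\mathcal{L}\subseteq U'\times X^*$, it is the system $$\big(\tfrac{\mathrm{d}}{\mathrm{d}t}x,f_r,-y,e,e_r,u\big)\in\mathcal{D},\qquad (f_r,e_r)\in L_r,\qquad (x,e)\in\mathcal{L}$$ with state $x$ (in $U'$), covector $e$, resistive port variables $(f_r,e_r)$ and external port variables $(u,y)$. Its energy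 is explicitly defined if $\mathcal{L}=\{(x,\partial_x K(x)) : x\in U'\}$ for a smooth function $K$ on $U'$; otherwise its energy is implicitly defined. Equivalence: a system is equivalent to a port-Hamiltonian system if its $u,y$ are the external port variables, its state variables $z_1,z_2$ are components of the state $x$, any further variables of the system are components of $e,f_r,e_r$ of the port-Hamiltonian system, and a trajectory solves the given system if and only if it can be completed by suitable remaining (latent) variables to a solution of the port-Hamiltonian system. ''$z_3$ is a free co-vector'' means: $X=Y\oplus\mathbb{R}^{n_3}$ for some space $Y$, $z_3$ is the component in $(\mathbb{R}^{n_3})^*$ of the covector $e=(e_Y,z_3)$, and this component is unconstrained by $\mathcal{L}$: if $(x,(e_Y,\zeta))\in\mathcal{L}$ then $(x,(e_Y,\zeta'))\in\mathcal{L}$ for every $\zeta'\in(\mathbb{R}^{n_3})^*$. *)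

(* Defs.v *)
From HB Require Import structures.
From mathcomp Require Import all_boot all_order all_algebra.
From mathcomp Require Import all_classical all_reals all_analysis.

Set Implicit Arguments.
Unset Strict Implicit.
Unset Printing Implicit Defensive.

Import Order.TTheory GRing.Theory Num.Theory.
Import numFieldNormedType.Exports.

Local Open Scope classical_set_scope.
Local Open Scope ring_scope.

(* [f] is C^infinity on the open set [A]: every iterated directional derivative
   of [f] is Frechet differentiable at every point of [A].  Functions on [A] are
   represented by total functions; as [A] is open, their values outside [A] are
   irrelevant. *)
Definition smooth_on (R : realType) (V W : normedModType R) (A : set V)
    (f : V -> W) : Prop :=
  forall vs : seq V, forall x : V, A x ->
    differentiable (foldr (fun v (g : V -> W) => 'D_v g) f vs) x.

Definition gradient (R : realType) (n : nat) (H : 'cV[R]_n -> R)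
    (x : 'cV[R]_n) : 'cV[R]_n :=
  \col_i 'D_(delta_mx i 0) H x.

(* R^n and its dual are identified via coordinates; elements of X (+) X^* are
   pairs (f, e) with f in X and e in X^*. *)
Definition pairing (R : realType) (n : nat) (e f : 'cV[R]_n) : R :=
  \sum_(i < n) e i 0 * f i 0.

Definition dirac_form (R : realType) (n : nat) (p q : 'cV[R]_n * 'cV[R]_n) : R :=
  pairing p.2 q.1 + pairing q.2 p.1.

Definition symplectic_form (R : realType) (n : nat)
    (p q : 'cV[R]_n * 'cV[R]_n) : R :=
  pairing p.2 q.1 - pairing q.2 p.1.

Definition self_orthogonal (R : realType) (V : vectType R) (b : V -> V -> R)
    (D : {vspace V}) : Prop :=
  forall p, p \in D <-> (forall q, q \in D -> b p q = 0).

Definition dirac_structure (R : realType) (n : nat)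
    (D : {vspace 'cV[R]_n * 'cV[R]_n}) : Prop :=
  self_orthogonal (@dirac_form R n) D.

Definition lagrangian_subspace (R : realType) (n : nat)
    (L : {vspace 'cV[R]_n * 'cV[R]_n}) : Prop :=
  self_orthogonal (@symplectic_form R n) L.

Definition nonnegative_subspace (R : realType) (n : nat)
    (L : {vspace 'cV[R]_n * 'cV[R]_n}) : Prop :=
  forall p, p \in L -> 0 <= pairing p.2 p.1.

(* Embedded smooth submanifolds, via slice charts: near each of its points, [M]
   is carried onto a piece of a linear subspace [E] by a diffeomorphism [phi]
   between open sets, with inverse [psi]. *)
Definition smooth_submanifold (R : realType) (V : normedModType R)
    (M : set V) : Prop :=
  forall p, M p ->
    exists (A B : set V) (phi psi : V -> V) (E : set V),
      [/\ [/\ open A, open B & A p],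
          smooth_on A phi /\ smooth_on B psi,
          (forall q, A q -> B (phi q) /\ psi (phi q) = q),
          (forall q, B q -> A (psi q) /\ phi (psi q) = q) &
          [/\ E 0,
              (forall (a : R) (v w : V), E v -> E w -> E (a *: v + w)) &
              forall q, A q -> (M q <-> E (phi q))]].

(* The tangent vectors of [M] at [p]: velocities of smooth curves in [M]. *)
Definition tangent_at (R : realType) (V : normedModType R) (M : set V)
    (p : V) : set V :=
  [set v | exists (eps : R) (c : R -> V),
    [/\ 0 < eps,
        smooth_on [set s : R | - eps < s < eps] c,
        (forall s : R, - eps < s < eps -> M (c s)),
        c 0 = p &
        derive1 c 0 = v]].

Definition lagrangian_submanifold (R : realType) (n : nat) (U : set 'cV[R]_n)
    (L : set ('cV[R]_n * 'cV[R]_n)) : Prop :=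
  [/\ (forall p, L p -> U p.1),
      smooth_submanifold L &
      forall p, L p ->
        exists T : {vspace 'cV[R]_n * 'cV[R]_n},
          (forall v, v \in T <-> tangent_at L p v) /\ lagrangian_subspace T].

(* Port-Hamiltonian systems with X = R^n, X_r = R^r, X_p = R^m. *)
Record ph_system (R : realType) (n r m : nat) := PHSystem {
  ph_domain : set 'cV[R]_n;
  ph_dirac : {vspace 'cV[R]_(n + r + m) * 'cV[R]_(n + r + m)};
  ph_resistive : {vspace 'cV[R]_r * 'cV[R]_r};
  ph_energy : set ('cV[R]_n * 'cV[R]_n);
  ph_domain_open : open ph_domain;
  ph_diracP : dirac_structure ph_dirac;
  ph_resistiveP : lagrangian_subspace ph_resistive;
  ph_resistive_ge0 : nonnegative_subspace ph_resistive;
  ph_energyP : lagrangian_submanifold ph_domain ph_energy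
}.

Definition explicit_energy (R : realType) (n r m : nat)
    (S : ph_system R n r m) : Prop :=
  exists K : 'cV[R]_n -> R,
    smooth_on (ph_domain S) K /\
    ph_energy S = [set p | ph_domain S p.1 /\ p.2 = gradient K p.1].

Definition implicit_energy (R : realType) (n r m : nat)
    (S : ph_system R n r m) : Prop := ~ explicit_energy S.

(* Bounded or unbounded open intervals. *)
Definition open_interval (R : realType) (t0 t1 : \bar R) : set R :=
  [set t | (t0 < t%:E < t1)%E].

Definition ph_solution (R : realType) (n r m : nat) (S : ph_system R n r m)
    (t0 t1 : \bar R) (x e : R -> 'cV[R]_n) (fr er : R -> 'cV[R]_r)
    (u y : R -> 'cV[R]_m) : Prop :=
  let I := open_interval t0 t1 in
  [/\ [/\ smooth_on I x, smooth_on I e, smooth_on I fr & smooth_on I er],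
      smooth_on I u /\ smooth_on I y &
      forall t, I t ->
        [/\ ph_domain S (x t),
            (col_mx (col_mx (derive1 x t) (fr t)) (- y t),
             col_mx (col_mx (e t) (er t)) (u t)) \in ph_dirac S,
            (fr t, er t) \in ph_resistive S &
            ph_energy S (x t, e t)]].

(* A dynamical system with state variables z, further variables w and external
   variables u, y, given by its trajectories (z, w, u, y) on each open interval
   (t0, t1). *)
Definition dyn_system (R : realType) (nz nw m : nat) :=
  \bar R -> \bar R -> (R -> 'cV[R]_nz) -> (R -> 'cV[R]_nw) ->
  (R -> 'cV[R]_m) -> (R -> 'cV[R]_m) -> Prop.

(* Equivalence to [S], where [sz] tells which components of the state x the
   state variables z are, and [sw] tells which components of (e, f_r, e_r) the
   further variables w are. *)
Definition equivalent_to_ph (R : realType) (nz nw m n r : nat)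
    (G : dyn_system R nz nw m) (S : ph_system R n r m)
    (sz : 'I_nz -> 'I_n) (sw : 'I_nw -> 'I_(n + (r + r))) : Prop :=
  [/\ injective sz, injective sw &
      forall (t0 t1 : \bar R) (z : R -> 'cV[R]_nz) (w : R -> 'cV[R]_nw)
             (u y : R -> 'cV[R]_m),
        G t0 t1 z w u y <->
        exists (x e : R -> 'cV[R]_n) (fr er : R -> 'cV[R]_r),
          ph_solution S t0 t1 x e fr er u y /\
          (forall t, open_interval t0 t1 t ->
             z t = rowsub sz (x t) /\
             w t = rowsub sw (col_mx (e t) (col_mx (fr t) (er t))))].

(* The component in (R^n3)^* of the covector, for X = Y (+) R^n3 with Y = R^k,
   is unconstrained by the energy. *)
Definition unconstrained_covector (R : realType) (k n3 r m : nat)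
    (S : ph_system R (k + n3) r m) : Prop :=
  forall (x : 'cV[R]_(k + n3)) (eY : 'cV[R]_k) (zeta zeta' : 'cV[R]_n3),
    ph_energy S (x, col_mx eY zeta) -> ph_energy S (x, col_mx eY zeta').

(* The position of that component inside (e, f_r, e_r). *)
Definition covector_index (k n3 r : nat) (i : 'I_n3) : 'I_(k + n3 + (r + r)) :=
  lshift (r + r) (rshift k i).

(* The system of the theorem, with z = (z1, z2) and w = z3. *)
Definition given_system (R : realType) (n1 n2 n3 m : nat)
    (U : set 'cV[R]_(n1 + n2)) (H : 'cV[R]_(n1 + n2) -> R)
    (J Rm : 'M[R]_(n1 + n2 + n3)) (B : 'M[R]_(n1 + n2 + n3, m)) :
    dyn_system R (n1 + n2) n3 m :=
  fun t0 t1 z z3 u y =>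
  let I := open_interval t0 t1 in
  let z1 := fun t => usubmx (z t) in
  let z2 := fun t => dsubmx (z t) in
  let d1H := fun t => usubmx (gradient H (z t)) in
  let d2H := fun t => dsubmx (gradient H (z t)) in
  [/\ smooth_on I z /\ smooth_on I z3,
      smooth_on I u /\ smooth_on I y &
      forall t, I t ->
        let v := col_mx (col_mx (derive1 z1 t) (d2H t)) (z3 t) in
        [/\ U (z t),
            col_mx (col_mx (d1H t) (derive1 z2 t)) 0 = (J - Rm) *m v + B *m u t &
            y t = B^T *m v]].

(* Main.v *)
Require Import Defs.
From HB Require Import structures.
From mathcomp Require Import all_boot all_order all_algebra.
From mathcomp Require Import ring.
From mathcomp Require Import lra.
From mathcomp Require Import all_classical all_reals all_analysis.
Import Order.TTheory GRing.Theory Num.Theory.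
Import numFieldNormedType.Exports.
Local Open Scope classical_set_scope.
Local Open Scope ring_scope.

(** The matrix equation pairs an input [v = (dz1/dt, d2 H, z3)] with an output
    [w = (d1 H, dz2/dt, 0)].  In each of its three blocks one of the two entries is
    a velocity and the other one a co-velocity of one and the same coordinate: the
    first block has the velocity on the input side, the other two have it on the
    output side.  Exchanging the roles of flow and effort on some coordinates keeps
    the duality pairing, so that [w = J v - er + B u], [y = B^T v], [fr = v] is a
    Dirac structure because [J] is skew ([dirac_ph_relation]), and the damping is
    the resistive relation [er = Rm fr], which is Lagrangian because [Rm] is
    symmetric and non-negative because [Rm] is positive semidefinite.

    In the third block the velocity is 0 and the effort [z3] is free.  This is what
    a coordinate [x3] does if the energy constrains it to [x3 = 0] and leaves its
    covector free.  One more coordinate of the same kind is always added, so that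
    the energy is implicit even if [n3 = 0]: a fibre of the energy over a point of
    the base contains several covectors, hence is not given by a gradient.  On that
    additional coordinate the Dirac structure prescribes effort 0.

    With [E] the inclusion of the [z]-space in the state space, the energy is
    [x = E E^T x], [E^T e = grad H (E^T x)], the generalised conormal bundle of [H]
    over the subspace [E E^T x = x].  Subtracting [E grad H (E^T x)] from the
    covector is a global chart that straightens it to a linear subspace
    ([conormal_energy_submanifold]).  Its tangent space at a point is
    [xi = E E^T xi], [E^T ep = S E^T xi] with [S] the Hessian of [H], and this is a
    Lagrangian subspace exactly because [S] is symmetric ([lagrangian_conormal]);
    the symmetry is Schwarz's theorem ([schwarz]).

    Finally, a trajectory determines its completion and conversely.  The one
    analytic point is that the completion is smooth: [e] contains
    [grad H (z t)], so a chain rule of all orders is needed ([smooth_comp]). *)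

Set Implicit Arguments.
Unset Strict Implicit.
Unset Printing Implicit Defensive.

(** * Calculus of smooth maps *)

(** Smoothness speaks of all iterated derivatives at once, which does not support an
    induction for products and compositions: the derivative of [f \o c] mixes
    derivatives of [f] and of [c].  The finite orders do: [Ck n] asks for the
    derivatives of order up to [n] to be differentiable. *)
Fixpoint Ck (R : realType) (V W : normedModType R) (n : nat) (A : set V)
    (f : V -> W) : Prop :=
  (forall x, A x -> differentiable f x) /\
  if n is n'.+1 then forall v, Ck n' A ('D_v f) else True.

Section Smooth.
Context {R : realType} {V : normedModType R}.
Implicit Types (W Z : normedModType R) (A : set V).

Lemma Ck_differentiable W n A (f : V -> W) x :
  Ck n A f -> A x -> differentiable f x.
Proof. by case: n => [|n] [df _]; exact: df. Qed.

Lemma smooth_onP W A (f : V -> W) :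
  smooth_on A f <-> forall n, Ck n A f.
Proof.
split=> [sf n|Cf vs].
  elim: n f sf => [|n IH] f sf /=; first by split=> // x Ax; exact: (sf [::]).
  split; first by move=> x Ax; exact: (sf [::]).
  by move=> v; apply: IH => vs x Ax; have := sf (rcons vs v) x Ax; rewrite foldr_rcons.
elim/last_ind: vs f Cf => [|vs v IH] f Cf x Ax /=.
  exact: Ck_differentiable (Cf 0%N) Ax.
rewrite foldr_rcons; apply: IH Ax => n.
by have [_ /(_ v)] := Cf n.+1.
Qed.

Lemma smooth_differentiable W A (f : V -> W) x :
  smooth_on A f -> A x -> differentiable f x.
Proof. by move=> sf; exact: (sf [::]). Qed.

Lemma smooth_derive W A (f : V -> W) v : smooth_on A f -> smooth_on A ('D_v f).
Proof. move=> /smooth_onP Cf; apply/smooth_onP => n; exact: (Cf n.+1).2 v. Qed.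

Lemma near_open A (P : V -> Prop) x : open A -> A x ->
  (forall y, A y -> P y) -> \near x, P x.
Proof.
move=> oA Ax AP; have : nbhs x A by exact: open_nbhs_nbhs.
exact: filterS.
Qed.

Lemma differentiable_near W (f g : V -> W) x :
  (\near x, f x = g x) -> differentiable f x -> differentiable g x.
Proof.
move=> fg /diff_locallyP[cdf fE].
have gE : g \o shift x = cst (g x) + 'd f x +o_ 0 id.
  apply/eqaddoP => e e0; have /eqaddoP/(_ _ e0) := fE.
  have fgx := nbhs_singleton fg.
  move: fg; rewrite (near_shift 0 x) subr0 => fg.
  by apply: filterS2 fg => h /= fgh; rewrite !fctE /= fgh -fgx.
have dg : 'd g x = 'd f x :> (V -> W) by exact: diff_unique.
by apply/diff_locallyP; rewrite dg.
Qed.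

Lemma Ck_ext W n A (f g : V -> W) : open A -> (forall x, A x -> f x = g x) ->
  Ck n A f -> Ck n A g.
Proof.
move=> oA; elim: n f g => [|n IH] f g fg [df Df] /=.
  split=> // x Ax; apply: differentiable_near (df _ Ax).
  exact: near_open fg.
split=> [x Ax|v].
  by apply: differentiable_near (df _ Ax); exact: near_open fg.
apply: IH (Df v) => x Ax; apply: near_eq_derive; exact: near_open fg.
Qed.

Lemma smooth_ext W A (f g : V -> W) : open A -> (forall x, A x -> f x = g x) ->
  smooth_on A f -> smooth_on A g.
Proof.
move=> oA fg /smooth_onP Cf; apply/smooth_onP => n.
exact: Ck_ext oA fg (Cf n).
Qed.

Lemma Ck_cst W n A (w : W) : Ck n A (fun=> w).
Proof.
elim: n w => [|n IH] w /=; first by split=> // x _; exact: differentiable_cst.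
split=> [x _|v]; first exact: differentiable_cst.
rewrite (_ : 'D_v _ = fun=> 0); first exact: IH.
by apply/funext => x; exact: derive_cst.
Qed.

Lemma CkD W n A (f g : V -> W) : open A -> Ck n A f -> Ck n A g ->
  Ck n A (fun x => f x + g x).
Proof.
move=> oA; elim: n f g => [|n IH] f g [df Df] [dg Dg] /=.
  by split=> // x Ax; apply: differentiableD; [exact: df|exact: dg].
split=> [x Ax|v]; first by apply: differentiableD; [exact: df|exact: dg].
apply: Ck_ext (IH _ _ (Df v) (Dg v)) => // x Ax.
by rewrite deriveD//; apply: diff_derivable; [exact: df|exact: dg].
Qed.

Lemma Ck_sum W n A (I : Type) (r : seq I) (f : I -> V -> W) : open A ->
  (forall i, Ck n A (f i)) -> Ck n A (fun x => \sum_(i <- r) f i x).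
Proof.
move=> oA Cf; elim: r => [|i r IH].
  by under eq_fun do rewrite big_nil; exact: Ck_cst.
by under eq_fun do rewrite big_cons; exact: CkD.
Qed.

Lemma Ck_le W n k A (f : V -> W) : (k <= n)%N -> Ck n A f -> Ck k A f.
Proof.
elim: n k f => [|n IH] [|k] f //= kn [df Df]; split=> // v.
exact: IH (Df v).
Qed.

Lemma CkM n A (f g : V -> R) : open A -> Ck n A f -> Ck n A g ->
  Ck n A (fun x => f x * g x).
Proof.
move=> oA; elim: n f g => [|n IH] f g [df Df] [dg Dg] /=.
  by split=> // x Ax; apply: differentiableM; [exact: df|exact: dg].
split=> [x Ax|v]; first by apply: differentiableM; [exact: df|exact: dg].
have Cf : Ck n A f by exact: (@Ck_le R n.+1).
have Cg : Ck n A g by exact: (@Ck_le R n.+1).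
apply: Ck_ext (CkD oA (IH _ _ Cf (Dg v)) (IH _ _ Cg (Df v))) => // x Ax.
by rewrite deriveM//; apply: diff_derivable; [exact: df|exact: dg].
Qed.

Lemma linear_diff W Z (L : W -> Z) x : linear L -> continuous L ->
  differentiable L x /\ forall v, 'D_v L x = L v.
Proof.
move=> linL cL; pose LM := GRing.isLinear.Build _ _ _ _ _ linL.
pose L' : {linear W -> Z} := HB.pack L LM.
have dL : differentiable L x by exact: (@linear_differentiable _ _ _ L').
by split=> // v; rewrite deriveE// (@diff_lin _ _ _ L').
Qed.

Lemma diff_compE W Z (f : V -> W) (g : W -> Z) x v :
  differentiable f x -> differentiable g (f x) ->
  'D_v (fun y => g (f y)) x = 'D_('D_v f x) g (f x).
Proof.
move=> df dg; rewrite (deriveE _ dg) (deriveE _ df).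
rewrite deriveE; last exact: (@differentiable_comp _ _ _ _ f g).
by rewrite -[fun y => _]/(g \o f) diff_comp.
Qed.

Lemma Ck_lin W Z n A (L : W -> Z) (f : V -> W) : open A ->
  linear L -> continuous L -> Ck n A f -> Ck n A (fun x => L (f x)).
Proof.
move=> oA linL cL.
have dL y := (linear_diff y linL cL).
have dLf (f' : V -> W) x : differentiable f' x -> differentiable (fun x => L (f' x)) x.
  by move=> df; apply: (@differentiable_comp _ _ _ _ f' L) => //; exact: (dL _).1.
elim: n f => [|n IH] f [df Df] /=.
  by split=> // x Ax; apply: dLf; exact: df.
split=> [x Ax|v]; first by apply: dLf; exact: df.
apply: Ck_ext (IH _ (Df v)) => // x Ax.
by rewrite (diff_compE v (df x Ax) (dL _).1) (dL _).2.
Qed.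

Lemma mx_sum_delta k (x : 'cV[R]_k) : x = \sum_i x i 0 *: delta_mx i 0.
Proof. by rewrite {1}[x]matrix_sum_delta; apply: eq_bigr => i _; rewrite big_ord1. Qed.

Lemma linear_delta W k (L : 'cV[R]_k -> W) x : linear L ->
  L x = \sum_i x i 0 *: L (delta_mx i 0).
Proof.
move=> linL; pose LM := GRing.isLinear.Build _ _ _ _ _ linL.
pose L' : {linear 'cV[R]_k -> W} := HB.pack L LM.
rewrite {1}[x]mx_sum_delta -[L _]/(L' _) linear_sum.
by apply: eq_bigr => i _; rewrite linearZ.
Qed.

Lemma linear_continuous W k (L : 'cV[R]_k -> W) : linear L -> continuous L.
Proof.
move=> linL; rewrite (_ : L = fun x : 'cV[R]_k => \sum_i x i 0 *: L (delta_mx i 0)).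
  apply: continuous_big; first exact: add_continuous.
  by move=> i _ x; apply: continuousZr_tmp; exact: coord_continuous.
by apply/funext => x; exact: linear_delta.
Qed.

Lemma derive_coord k (f : 'cV[R]_k -> R) y w : differentiable f y ->
  'D_w f y = \sum_i w i 0 * 'D_(delta_mx i 0) f y.
Proof.
move=> df; rewrite deriveE//.
have lin_df : linear ('d f y) by exact: linearP.
apply: etrans (linear_delta w lin_df) _.
by apply: eq_bigr => i _; rewrite deriveE.
Qed.

(** By induction on the order.  The derivative of [f \o c] along [v] is the sum of the products of
    ['D_v c x i] and of [f_i (c x)], with [f_i] the partial derivatives of [f].  Both
    factors are again of the form handled by the induction, one order lower. *)
Lemma Ck_comp k n (U : set 'cV[R]_k) A (f : 'cV[R]_k -> R) (c : V -> 'cV[R]_k) :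
  open A -> (forall x, A x -> U (c x)) -> Ck n U f -> Ck n A c ->
  Ck n A (fun x => f (c x)).
Proof.
move=> oA AU; elim: n f => [|n IH] f [df Df] [dc Dc] /=.
  split=> // x Ax; apply: (@differentiable_comp _ _ _ _ c f); first exact: dc.
  by apply: df; exact: AU.
split=> [x Ax|v].
  apply: (@differentiable_comp _ _ _ _ c f); first exact: dc.
  by apply: df; exact: AU.
have Cc : Ck n A c by exact: (@Ck_le _ n.+1).
have coordL i : linear (fun y : 'cV[R]_k => y i 0 : R).
  by move=> a y z; rewrite !mxE.
apply: (@Ck_ext _ n A (fun x => \sum_i ('D_v c x) i 0 * 'D_(delta_mx i 0) f (c x))) => //.
  move=> x Ax; have dfx := df _ (AU _ Ax).
  by rewrite (diff_compE v (dc x Ax) dfx) derive_coord.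
apply: Ck_sum => // i; apply: CkM => //.
  exact: (Ck_lin oA (coordL i) (@coord_continuous R k 1 i 0) (Dc v)).
exact: IH (Df _) Cc.
Qed.

End Smooth.

Section SmoothTools.
Context {R : realType} {V : normedModType R}.
Implicit Types (W Z : normedModType R) (A : set V).

Lemma smooth_cst W A (w : W) : smooth_on A (fun=> w).
Proof. by apply/smooth_onP => n; exact: Ck_cst. Qed.

Lemma smooth_id A : smooth_on A id.
Proof.
apply/smooth_onP => -[|n] /=; split=> // v.
rewrite (_ : 'D_v id = fun=> v); first exact: Ck_cst.
by apply/funext => x; exact: derive_id.
Qed.

Lemma smoothD W A (f g : V -> W) : open A -> smooth_on A f -> smooth_on A g ->
  smooth_on A (fun x => f x + g x).
Proof.
move=> oA /smooth_onP Cf /smooth_onP Cg; apply/smooth_onP => n.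
exact: CkD.
Qed.

Lemma smooth_lin W Z A (L : W -> Z) (f : V -> W) : open A ->
  linear L -> continuous L -> smooth_on A f -> smooth_on A (fun x => L (f x)).
Proof.
by move=> oA linL cL /smooth_onP Cf; apply/smooth_onP => n; exact: Ck_lin.
Qed.

Lemma smoothN W A (f : V -> W) : open A -> smooth_on A f ->
  smooth_on A (fun x => - f x).
Proof.
move=> oA; apply: (@smooth_lin _ _ _ (fun w : W => - w)) => //.
  by move=> a u v; rewrite opprD scalerN.
exact: opp_continuous.
Qed.

Lemma mulmx_linear_fun k l (M : 'M[R]_(l, k)) : linear (fun x : 'cV[R]_k => M *m x).
Proof. by move=> a u v; rewrite mulmxDr scalemxAr. Qed.

Lemma smooth_mulmx k l (M : 'M[R]_(l, k)) A (f : V -> 'cV[R]_k) : open A ->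
  smooth_on A f -> smooth_on A (fun x => M *m f x).
Proof.
move=> oA; apply: (@smooth_lin _ _ _ (fun x : 'cV[R]_k => M *m x)) => //.
  exact: mulmx_linear_fun.
exact/linear_continuous/mulmx_linear_fun.
Qed.

Lemma smooth_coord k A (f : V -> 'cV[R]_k) i : open A ->
  smooth_on A f -> smooth_on A (fun x => f x i 0).
Proof.
move=> oA; apply: (@smooth_lin _ _ _ (fun x : 'cV[R]_k => x i 0 : R)) => //.
  by move=> a u v; rewrite !mxE.
exact: coord_continuous.
Qed.

Lemma smooth_mx k A (f : V -> 'cV[R]_k) : open A ->
  (forall i, smooth_on A (fun x => f x i 0)) -> smooth_on A f.
Proof.
move=> oA sf; apply: (@smooth_ext _ _ _ _ (fun x => \sum_i f x i 0 *: delta_mx i 0)) => //.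
  by move=> x _; rewrite -mx_sum_delta.
apply/smooth_onP => n; apply: Ck_sum => // i.
apply: (@Ck_lin _ _ _ _ _ _ (fun a : R => a *: (delta_mx i 0 : 'cV[R]_k))) => //.
- by move=> a u v; rewrite scalerDl scalerA.
- exact: scalel_continuous.
- exact: (iffLR (smooth_onP _ _) (sf i)).
Qed.

Lemma smooth_col k l A (f : V -> 'cV[R]_k) (g : V -> 'cV[R]_l) : open A ->
  smooth_on A f -> smooth_on A g -> smooth_on A (fun x => col_mx (f x) (g x)).
Proof.
move=> oA sf sg; apply: smooth_mx => // i.
under eq_fun do rewrite mxE; case: (fintype.split i) => j; exact: smooth_coord.
Qed.

Lemma smooth_pair W Z A (f : V -> W) (g : V -> Z) : open A ->
  smooth_on A f -> smooth_on A g -> smooth_on A (fun x => (f x, g x)).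
Proof.
move=> oA sf sg.
apply: (@smooth_ext _ _ _ _ (fun x => (f x, 0) + (0, g x))) => //.
  by move=> x _; apply: injective_projections; rewrite /= ?addr0 ?add0r.
apply: smoothD => //.
  apply: (@smooth_lin _ _ _ (fun w : W => (w, 0 : Z))) => //.
    by move=> a u v; apply: injective_projections; rewrite /= ?scaler0 ?addr0.
  by move=> w; apply: cvg_pair => //; exact: cvg_cst.
apply: (@smooth_lin _ _ _ (fun w : Z => (0 : W, w))) => //.
  by move=> a u v; apply: injective_projections; rewrite /= ?scaler0 ?addr0.
by move=> w; apply: cvg_pair => //; exact: cvg_cst.
Qed.

Lemma smooth_fst W Z A (f : V -> W * Z) : open A ->
  smooth_on A f -> smooth_on A (fun x => (f x).1).
Proof. by move=> oA; apply: smooth_lin => //; move=> x; exact: cvg_fst. Qed.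

Lemma smooth_snd W Z A (f : V -> W * Z) : open A ->
  smooth_on A f -> smooth_on A (fun x => (f x).2).
Proof. by move=> oA; apply: smooth_lin => //; move=> x; exact: cvg_snd. Qed.

Lemma derive_lin W Z (L : W -> Z) (f : V -> W) x v : linear L -> continuous L ->
  differentiable f x -> 'D_v (fun y => L (f y)) x = L ('D_v f x).
Proof.
move=> linL cL df; have [dL DL] := linear_diff (f x) linL cL.
by rewrite diff_compE.
Qed.

Lemma derive_mulmx k l (M : 'M[R]_(l, k)) (f : V -> 'cV[R]_k) x v :
  differentiable f x -> 'D_v (fun y => M *m f y) x = M *m 'D_v f x.
Proof.
move=> df; rewrite (@derive_lin _ _ (fun y => M *m y))//.
  exact: mulmx_linear_fun.
exact/linear_continuous/mulmx_linear_fun.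
Qed.

Lemma derive_coordE k (f : V -> 'cV[R]_k) x v i :
  differentiable f x -> 'D_v (fun y => f y i 0) x = 'D_v f x i 0.
Proof.
move=> df; rewrite (@derive_lin _ _ (fun y : 'cV[R]_k => y i 0 : R))//.
  by move=> a u w; rewrite !mxE.
exact: coord_continuous.
Qed.

End SmoothTools.

(** The target is a space of columns, so the components reduce this to [Ck_comp]. *)
Lemma smooth_comp (R : realType) (V : normedModType R) k l (U : set 'cV[R]_k)
    (A : set V) (g : 'cV[R]_k -> 'cV[R]_l) (c : V -> 'cV[R]_k) :
  open U -> open A -> (forall x, A x -> U (c x)) -> smooth_on U g ->
  smooth_on A c -> smooth_on A (fun x => g (c x)).
Proof.
move=> oU oA AU sg sc; apply: smooth_mx => // i.
have /smooth_onP Cg := smooth_coord i oU sg; move/smooth_onP: sc => Cc.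
apply/smooth_onP => n; exact: (Ck_comp oA AU (Cg n) (Cc n)).
Qed.

Section Submx.
Context {R : realType} {V : normedModType R} {k l : nat}.
Implicit Types (A : set V) (f : V -> 'cV[R]_(k + l)).

Let linear_u : linear (@usubmx R k l 1). Proof. exact: linearP. Qed.
Let linear_d : linear (@dsubmx R k l 1). Proof. exact: linearP. Qed.

Lemma smooth_usubmx A f : open A -> smooth_on A f ->
  smooth_on A (fun x => usubmx (f x)).
Proof. by move=> oA; apply: smooth_lin => //; exact: linear_continuous. Qed.

Lemma smooth_dsubmx A f : open A -> smooth_on A f ->
  smooth_on A (fun x => dsubmx (f x)).
Proof. by move=> oA; apply: smooth_lin => //; exact: linear_continuous. Qed.

Lemma derive_usubmx f x v : differentiable f x ->
  'D_v (fun y => usubmx (f y)) x = usubmx ('D_v f x).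
Proof. by apply: derive_lin => //; exact: linear_continuous. Qed.

Lemma derive_dsubmx f x v : differentiable f x ->
  'D_v (fun y => dsubmx (f y)) x = dsubmx ('D_v f x).
Proof. by apply: derive_lin => //; exact: linear_continuous. Qed.

End Submx.

Section Line.
Context {R : realType} {V : normedModType R}.
Implicit Types a b : V.

Lemma smooth_line (I : set R) a b : open I -> smooth_on I (fun s : R => a + s *: b).
Proof.
move=> oI; apply: smoothD => //; first exact: smooth_cst.
apply: (@smooth_lin _ _ _ _ _ (fun t : R => t *: b)) => //.
- by move=> ? ? ?; rewrite scalerDl scalerA.
- exact: scalel_continuous.
- exact: smooth_id.
Qed.

Lemma derive_line a b (s : R) : 'D_1 (fun s : R => a + s *: b) s = b.
Proof.
rewrite -[fun s : R => _]/(cst a + (fun s : R => s *: b)) deriveD//; last first.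
  exact: diff_derivable.
by rewrite derive_cst add0r deriveE// diff_val scale1r.
Qed.

End Line.

Lemma open_open_interval (R : realType) (t0 t1 : \bar R) : open (open_interval t0 t1).
Proof.
have -> : open_interval t0 t1 =
    [set t | (t0 < t%:E)%E] `&` [set t | (t%:E < t1)%E].
  by apply/seteqP; split=> t; [move=> /andP[]|move=> [t0t tt1]; apply/andP].
apply: openI; [exact: open_ereal_gt|exact: open_ereal_lt].
Qed.

Lemma open_sym_itv (R : realType) (eps : R) : open [set s : R | - eps < s < eps].
Proof.
rewrite (_ : [set s | _] = [set` `]- eps, eps[]); first exact: interval_open.
by apply/seteqP; split=> s /=; rewrite in_itv.
Qed.

(** * Symmetry of second derivatives *)

Lemma diff_remainder (R : realType) (V W : normedModType R) (g : V -> W) x e :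
  differentiable g x -> 0 < e -> exists2 d, 0 < d & forall k, `|k| < d ->
    `|g (x + k) - g x - 'd g x k| <= e * `|k|.
Proof.
move=> dg e0; have /eqaddoP/(_ _ e0)/nbhs_normP[d /= d0 dP] := diff_locally dg.
exists d => // k kd; have := dP k; rewrite /ball_ /= sub0r normrN => /(_ kd).
by rewrite !fctE /= opprD addrA [k + x]addrC.
Qed.

Section Schwarz.
Context {R : realType} {V : normedModType R}.
Variables (A : set V) (f : V -> R) (x : V).
Hypotheses (oA : open A) (Ax : A x) (df : forall y, A y -> differentiable f y).

Let delta (a b : V) (h : R) :=
  f (x + h *: a + h *: b) - f (x + h *: a) - (f (x + h *: b) - f x).

(** Mean value theorem for [s |-> f (x + s a + h b) - f (x + s a)], whose derivative
    is the increment of ['D_a f] between two points at distance [h b]; the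
    differentiability of ['D_a f] at [x] replaces that increment by
    [h 'D_b ('D_a f) x] up to an error that is small compared with [h]. *)
Lemma second_difference a b e : differentiable ('D_a f) x -> 0 < e ->
  exists2 d, 0 < d & forall h, 0 < h < d ->
    `|delta a b h - h ^+ 2 * 'D_b ('D_a f) x| <= e * h ^+ 2.
Proof.
move=> dg e0; set g := 'D_a f in dg *.
(* For [0 <= s <= h] the distances of [x + s a + h b] and of [x + s a] from [x] add up
   to at most [h (2 |a| + |b|)]; the summand 1 makes [M] positive. *)
set M := 2 * `|a| + `|b| + 1.
have M0 : 0 < M by rewrite ltr_wpDl// addr_ge0// mulr_ge0.
have [d1 d10 gP] := diff_remainder dg (divr_gt0 e0 M0).
have /nbhs_normP[d2 /= d20 AP] : nbhs x A by exact: open_nbhs_nbhs.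
exists (Num.min d1 d2 / M); first by rewrite divr_gt0// lt_min d10.
move=> h /andP[h0]; rewrite ltr_pdivlMr// lt_min => /andP[hd1 hd2].
have small s t : 0 <= s <= h -> 0 <= t <= h -> `|s *: a + t *: b| <= h * (`|a| + `|b|).
  move=> /andP[s0 sh] /andP[t0 th]; apply: (le_trans (ler_normD _ _)).
  rewrite !normrZ (ger0_norm s0) (ger0_norm t0) mulrDr.
  by rewrite lerD// ler_wpM2r.
have hM : h * (`|a| + `|b|) < h * M.
  rewrite ltr_pM2l// /M mulr_natl mulr2n; have := normr_ge0 a; lra.
have h0h : 0 <= h <= h by rewrite lexx ltW.
have h00 : 0 <= (0 : R) <= h by rewrite lexx ltW.
have inA s t : 0 <= s <= h -> 0 <= t <= h -> A (x + s *: a + t *: b).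
  move=> hs ht; apply: AP; rewrite /ball_ /= -addrA opprD addNKr normrN.
  exact: le_lt_trans (small _ _ hs ht) (lt_trans hM hd2).
pose phi s := f (x + s *: a + h *: b) - f (x + s *: a).
have inA0 s : 0 <= s <= h -> A (x + s *: a).
  by move=> hs; have := inA s 0 hs h00; rewrite scale0r addr0.
have der c s : A (c + s *: a) ->
    is_derive s 1 (fun s : R => f (c + s *: a)) (g (c + s *: a)).
  move=> Ac.
  have dl : differentiable (fun s : R => c + s *: a) s by [].
  split.
    apply: diff_derivable; apply: (@differentiable_comp _ _ _ _ _ f) => //.
    exact: df.
  rewrite diff_compE//; first by rewrite derive_line.
  exact: df.
have phi' s : 0 <= s <= h ->
    is_derive s 1 phi (g (x + s *: a + h *: b) - g (x + s *: a)).
  move=> hs; apply: is_deriveB; last by apply: der; exact: inA0.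
  rewrite addrAC; under eq_fun do rewrite addrAC.
  by apply: der; rewrite addrAC; exact: inA.
have [s sI| |s sI phiE] := @MVT_segment R phi
  (fun s => g (x + s *: a + h *: b) - g (x + s *: a)) 0 h (ltW h0).
- by apply: phi'; move: sI; rewrite in_itv /= => /andP[/ltW -> /ltW ->].
- apply: derivable_within_continuous => s sI.
  by have [] := phi' s; rewrite in_itv in sI.
have {sI} hs : 0 <= s <= h by move: sI; rewrite in_itv.
have -> : delta a b h = phi h - phi 0 by rewrite /phi scale0r addr0.
rewrite phiE subr0.
have bnd k : `|k| <= h * (`|a| + `|b|) -> `|g (x + k) - g x - 'd g x k| <= e / M * `|k|.
  by move=> kh; apply: gP; exact: le_lt_trans kh (lt_trans hM hd1).
have h1 := bnd _ (small s h hs h0h).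
have h2 := bnd _ (small s 0 hs h00).
rewrite scale0r addr0 in h2.
have -> : (g (x + s *: a + h *: b) - g (x + s *: a)) * h - h ^+ 2 * 'D_b g x =
  ((g (x + (s *: a + h *: b)) - g x - 'd g x (s *: a + h *: b)) -
  (g (x + s *: a) - g x - 'd g x (s *: a))) * h.
  (* The increments along [s a] cancel, and what is left is that along [h b]. *)
  have -> : 'd g x (s *: a + h *: b) = 'd g x (s *: a) + h * 'd g x b.
    by rewrite linearD [X in _ + X]linearZ.
  by rewrite deriveE// addrA; ring.
rewrite normrM (gtr0_norm h0) expr2 mulrA ler_pM2r//.
apply: (le_trans (ler_normB _ _)); apply: (le_trans (lerD h1 h2)).
rewrite -mulrDr -mulrA ler_pM2l// mulrC ler_pdivrMr//.
case/andP: hs => s0 sh.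
have sa : `|s *: a| <= h * `|a| by rewrite normrZ (ger0_norm s0) ler_wpM2r.
have := ler_normD (s *: a) (h *: b); rewrite [`|h *: b|]normrZ (gtr0_norm h0).
rewrite /M; lra.
Qed.

End Schwarz.

(** The second difference is symmetric in the two directions, and divided by [h ^+ 2]
    it tends to either mixed derivative. *)
Lemma schwarz (R : realType) (V : normedModType R) (A : set V) (f : V -> R)
    (x a b : V) : open A -> A x -> (forall y, A y -> differentiable f y) ->
  differentiable ('D_a f) x -> differentiable ('D_b f) x ->
  'D_b ('D_a f) x = 'D_a ('D_b f) x.
Proof.
move=> oA Ax df dfa dfb; apply/eqP; rewrite -subr_eq0 -normr_le0.
apply/ler_addgt0Pl => e e0; rewrite addr0.
have e20 : 0 < e / 2 by rewrite divr_gt0.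
have [d1 d10 h1] := second_difference oA Ax df b dfa e20.
have [d2 d20 h2] := second_difference oA Ax df a dfb e20.
pose h := Num.min d1 d2 / 2.
have m0 : 0 < Num.min d1 d2 by rewrite lt_min d10.
have h0 : 0 < h by rewrite divr_gt0.
have hm : h < Num.min d1 d2 by rewrite /h ltr_pdivrMr// mulr_natr mulr2n ltrDl.
move: (hm); rewrite lt_min => /andP[hd1 hd2].
have {}h1 := h1 h (introT andP (conj h0 hd1)).
have {}h2 := h2 h (introT andP (conj h0 hd2)).
have hh : 0 < h ^+ 2 by rewrite exprn_gt0.
rewrite -(ler_pM2r hh) -{1}(gtr0_norm hh) -normrM.
rewrite [X in _ <= X * _](splitr e) [X in _ <= X]mulrDl.
apply: (le_trans _ (lerD h2 h1)); apply: (le_trans _ (ler_normB _ _)).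
rewrite [x + h *: b + _]addrAC le_eqVlt; apply/orP; left; apply/eqP.
congr (`| _ |).
move: (f (x + h *: a + _)) (f (x + h *: a)) (f (x + h *: b)) (f x).
move: ('D_b ('D_a f) x) ('D_a ('D_b f) x) => D1 D2 w1 w2 w3 w4.
by ring.
Qed.

(** * Linear subspaces and the duality pairing *)

(** Lets a subspace be given by its equations.  A subspace of maximal dimension
    contained in [P] is all of [P]: adding a missing vector would enlarge it. *)
Lemma vspace_of_pred (K : fieldType) (V : vectType K) (P : V -> Prop) :
  P 0 -> (forall a u v, P u -> P v -> P (a *: u + v)) ->
  exists D : {vspace V}, forall p, p \in D <-> P p.
Proof.
move=> P0 Plin.
pose Q d := `[< exists D : {vspace V}, (forall p, p \in D -> P p) /\ \dim D = d >].
have exQ : exists d, Q d.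
  exists 0%N; apply/asboolP; exists 0%VS; split; last exact: dimv0.
  by move=> p; rewrite memv0 => /eqP->.
have ubQ d : Q d -> (d <= \dim {:V})%N.
  by move=> /asboolP[D [_ <-]]; exact/dimvS/subvf.
case: (ex_maxnP exQ ubQ) => d /asboolP[D [DP dimD]] maxd.
exists D => p; split=> [/DP//|Pp]; have [//|pD] := boolP (p \in D).
have : (\dim (D + <[p]>)%VS <= d)%N.
  apply: maxd; apply/asboolP; exists (D + <[p]>)%VS; split=> // q.
  move=> /memv_addP[u uD [_ /vlineP[a ->] ->]].
  by rewrite addrC; apply: Plin => //; exact: DP.
rewrite dimv_disjoint_sum.
  rewrite dimD dim_vline; case: eqVneq pD => [->|_ _]; first by rewrite mem0v.
  by rewrite addn1 ltnn.
apply/eqP; rewrite -subv0; apply/subvP => q; rewrite memv_cap => /andP[qD].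
move=> /vlineP[a qE]; rewrite memv0 qE; have [->|a0] := eqVneq a 0.
  by rewrite scale0r.
by move: qD; rewrite qE rpredZeq (negbTE a0) (negbTE pD).
Qed.

Section Pairing.
Context {R : realType}.

Lemma pairingE n (e f : 'cV[R]_n) : pairing e f = (e^T *m f) 0 0.
Proof. by rewrite /pairing mxE; apply: eq_bigr => i _; rewrite mxE. Qed.

Lemma pairingC n (e f : 'cV[R]_n) : pairing e f = pairing f e.
Proof. by apply: eq_bigr => i _; rewrite mulrC. Qed.

Lemma pairingDr n (e f g : 'cV[R]_n) : pairing e (f + g) = pairing e f + pairing e g.
Proof. by rewrite !pairingE mulmxDr mxE. Qed.

Lemma pairingNr n (e f : 'cV[R]_n) : pairing e (- f) = - pairing e f.
Proof. by rewrite !pairingE mulmxN mxE. Qed.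

Lemma pairing0r n (e : 'cV[R]_n) : pairing e 0 = 0.
Proof. by rewrite pairingE mulmx0 mxE. Qed.

Lemma pairingDl n (e f g : 'cV[R]_n) : pairing (f + g) e = pairing f e + pairing g e.
Proof. by rewrite pairingC pairingDr !(pairingC e). Qed.

Lemma pairingNl n (e f : 'cV[R]_n) : pairing (- f) e = - pairing f e.
Proof. by rewrite pairingC pairingNr pairingC. Qed.

Lemma pairing0l n (e : 'cV[R]_n) : pairing 0 e = 0.
Proof. by rewrite pairingC pairing0r. Qed.

Lemma pairing_mulmx n k (M : 'M[R]_(n, k)) e f :
  pairing e (M *m f) = pairing (M^T *m e) f.
Proof. by rewrite !pairingE trmx_mul trmxK mulmxA. Qed.

Lemma pairing_col n k (e f : 'cV[R]_(n + k)) :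
  pairing e f = pairing (usubmx e) (usubmx f) + pairing (dsubmx e) (dsubmx f).
Proof.
rewrite /pairing big_split_ord; congr (_ + _).
  by apply: eq_bigr => i _; rewrite !mxE.
by apply: eq_bigr => i _; rewrite !mxE.
Qed.

Lemma pairing_eq0 n (e : 'cV[R]_n) : (forall f, pairing e f = 0) -> e = 0.
Proof.
move=> e0; apply/colP => i; have := e0 (delta_mx i 0); rewrite /pairing.
rewrite (bigD1 i)//= big1 => [|j ji]; last by rewrite mxE (negbTE ji) mulr0.
by rewrite !mxE !eqxx mulr1 addr0.
Qed.

Definition pairing_linear :=
  (pairingDr, pairingDl, pairingNr, pairingNl, pairing0r, pairing0l).

End Pairing.

(** With [p = (E zeta, e)] and [q = (E zeta', e')] the symplectic form becomes
    [<S zeta, zeta'> - <S zeta', zeta>], which vanishes by symmetry.  Conversely, the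
    test vectors [(0, e')] with [e'] in the kernel of [E^T] force [p.1] into the range
    of [E], and [(E f, E S f)] yield the equation for [p.2].  For [E = 1] this is the
    graph of [S]. *)
Lemma lagrangian_conormal (R : realType) (n k : nat) (E : 'M[R]_(n, k)) (S : 'M[R]_k) :
  E^T *m E = 1%:M -> S = S^T ->
  exists2 L : {vspace 'cV[R]_n * 'cV[R]_n},
    forall p, p \in L <-> p.1 = E *m (E^T *m p.1) /\ E^T *m p.2 = S *m (E^T *m p.1)
    & lagrangian_subspace L.
Proof.
move=> EtE symS.
have [L LP] : exists L : {vspace 'cV[R]_n * 'cV[R]_n},
    forall p, p \in L <-> p.1 = E *m (E^T *m p.1) /\ E^T *m p.2 = S *m (E^T *m p.1).
  apply: vspace_of_pred => [|a u v /= [u1 u2] [v1 v2]]; first by rewrite !mulmx0.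
  by rewrite !mulmxDr -!scalemxAr -u1 -v1 u2 v2.
exists L => // p; rewrite LP /symplectic_form.
split=> [[p1 p2] q /LP[q1 q2]|pL].
  rewrite p1 q1 !(pairing_mulmx E) p2 q2 [X in X - _]pairingC.
  by rewrite (pairing_mulmx S) -symS subrr.
split; apply/eqP; rewrite -subr_eq0; apply/eqP/pairing_eq0 => f.
  have /pL /= : (0, f - E *m (E^T *m f)) \in L.
    by apply/LP; rewrite /= !mulmx0 mulmxBr !mulmxA EtE mul1mx subrr.
  rewrite pairing0r sub0r => /eqP; rewrite oppr_eq0 => /eqP.
  rewrite !pairing_linear => /eqP; rewrite subr_eq0 => /eqP fE.
  rewrite pairingC fE [pairing (E *m (E^T *m p.1)) f]pairingC.
  by rewrite (pairing_mulmx E) (pairing_mulmx E^T) trmxK subrr.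
have /pL /= : (E *m f, E *m (S *m f)) \in L.
  by apply/LP; rewrite /= !mulmxA EtE !mul1mx -!mulmxA [E^T *m _]mulmxA EtE mul1mx.
rewrite !pairing_linear (pairing_mulmx E) => <-; congr (_ - _).
by rewrite [RHS]pairingC (pairing_mulmx E) (pairing_mulmx S) -symS.
Qed.

(** * The Dirac structure *)

Section Dirac.
Context {R : realType} {n1 n2 n3 m : nat}.
Local Notation N := (n1 + n2 + n3)%N.
Local Notation n := (n1 + n2 + 1 + n3)%N.

(** The coordinates of a state are [z1], [z2], a scalar, and [x3].  [hybrid f e] takes
    the flow on [z1] and the effort on [z2] and [x3], so that [hybrid e f] collects the
    complementary data: for [f] the velocity of the state and [e] its covector these
    are the input and the output of the matrix equation. *)
Definition hybrid (f e : 'cV[R]_n) : 'cV[R]_N :=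
  col_mx (col_mx (usubmx (usubmx (usubmx f))) (dsubmx (usubmx (usubmx e))))
    (dsubmx e).

Lemma hybridP a (f e f' e' : 'cV[R]_n) :
  hybrid (a *: f + f') (a *: e + e') = a *: hybrid f e + hybrid f' e'.
Proof. by rewrite /hybrid !linearP /= !scale_col_mx !add_col_mx. Qed.

(** Exchanging flow and effort on some coordinates preserves the symmetric form; the
    scalar coordinate, which [hybrid] omits, contributes separately. *)
Lemma pairing_hybrid (f e f' e' : 'cV[R]_n) :
  pairing e f' + pairing e' f =
  pairing (hybrid e f) (hybrid f' e') + pairing (hybrid e' f') (hybrid f e) +
  (pairing (dsubmx (usubmx e)) (dsubmx (usubmx f')) +
   pairing (dsubmx (usubmx e')) (dsubmx (usubmx f))).
Proof.
have xE (a b : 'cV[R]_n) : pairing a b =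
    pairing (usubmx (usubmx (usubmx a))) (usubmx (usubmx (usubmx b))) +
    pairing (dsubmx (usubmx (usubmx a))) (dsubmx (usubmx (usubmx b))) +
    pairing (dsubmx (usubmx a)) (dsubmx (usubmx b)) + pairing (dsubmx a) (dsubmx b).
  by rewrite pairing_col; congr (_ + _); rewrite pairing_col; congr (_ + _);
    exact: pairing_col.
have hE (a b c d : 'cV[R]_n) : pairing (hybrid a b) (hybrid c d) =
    pairing (usubmx (usubmx (usubmx a))) (usubmx (usubmx (usubmx c))) +
    pairing (dsubmx (usubmx (usubmx b))) (dsubmx (usubmx (usubmx d))) +
    pairing (dsubmx b) (dsubmx d).
  by rewrite pairing_col !(col_mxKu, col_mxKd) pairing_col !(col_mxKu, col_mxKd).
rewrite !xE !hE.
rewrite [pairing (dsubmx (usubmx (usubmx f))) _]pairingC.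
rewrite [pairing (dsubmx (usubmx (usubmx f'))) _]pairingC.
by rewrite [pairing (dsubmx f) _]pairingC [pairing (dsubmx f') _]pairingC; ring.
Qed.

Lemma hybrid_onto (v w : 'cV[R]_N) (d : 'cV[R]_1) :
  exists f e, [/\ hybrid f e = v, hybrid e f = w, dsubmx (usubmx f) = d &
    dsubmx (usubmx e) = 0].
Proof.
exists (col_mx (col_mx (col_mx (usubmx (usubmx v)) (dsubmx (usubmx w))) d)
  (dsubmx w)).
exists (col_mx (col_mx (col_mx (usubmx (usubmx w)) (dsubmx (usubmx v))) 0)
  (dsubmx v)).
by rewrite /hybrid !(col_mxKu, col_mxKd) !vsubmxK.
Qed.

Variables (J : 'M[R]_N) (B : 'M[R]_(N, m)).

Definition ph_relation (f e : 'cV[R]_(n + N + m)) : Prop :=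
  let v := hybrid (usubmx (usubmx f)) (usubmx (usubmx e)) in
  let w := hybrid (usubmx (usubmx e)) (usubmx (usubmx f)) in
  [/\ dsubmx (usubmx f) = v, dsubmx f = - (B^T *m v),
      w = J *m v - dsubmx (usubmx e) + B *m dsubmx e &
      dsubmx (usubmx (usubmx (usubmx e))) = 0].

(** The relation leaves the input [v'], the resistive effort, the port effort and the
    scalar velocity of [q] free.  Written in them, the form [dirac_form p q] has as
    coefficients exactly the defects of the equations of the relation at [p], because
    [J] is skew.  So it vanishes for all [q] if and only if [p] satisfies the
    equations. *)
Lemma dirac_ph_relation : J + J^T = 0 ->
  exists2 D : {vspace 'cV[R]_(n + N + m) * 'cV[R]_(n + N + m)},
    forall p, p \in D <-> ph_relation p.1 p.2 & dirac_structure D.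
Proof.
move=> skewJ.
have JT : J^T = - J by apply/eqP; rewrite -addr_eq0 addrC skewJ.
have [D DP] : exists D : {vspace 'cV[R]_(n + N + m) * 'cV[R]_(n + N + m)},
    forall p, p \in D <-> ph_relation p.1 p.2.
  apply: vspace_of_pred => [|a u v].
    have h0 : hybrid 0 0 = 0.
      by have := hybridP (-1) 0 0 0 0; rewrite !scaler0 addr0 scaleN1r addNr.
    by rewrite /ph_relation /= !linear0 h0 !mulmx0 oppr0 !addr0.
  rewrite /ph_relation /= !linearP /= !hybridP.
  move=> [-> -> -> ->] [-> -> -> ->]; split=> //.
  + by rewrite mulmxDr -scalemxAr; apply/colP => i; rewrite !mxE; ring.
  + rewrite !mulmxDr -!scalemxAr.
    move: (J *m hybrid (usubmx (usubmx u.1)) _) (J *m hybrid (usubmx (usubmx v.1)) _).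
    move: (B *m dsubmx u.2) (B *m dsubmx v.2) => b b' j j'.
    by apply/colP => i; rewrite !mxE; ring.
  + by rewrite scaler0 addr0.
exists D => // p; rewrite DP.
rewrite /ph_relation; case: p => f e /=.
set v := hybrid (usubmx (usubmx f)) _; set w := hybrid (usubmx (usubmx e)) _.
set fr := dsubmx (usubmx f); set er := dsubmx (usubmx e).
set fp := dsubmx f; set ep := dsubmx e.
set ed := dsubmx (usubmx (usubmx (usubmx e))).
have formE (q : 'cV[R]_(n + N + m) * 'cV[R]_(n + N + m)) : ph_relation q.1 q.2 ->
  let v' := hybrid (usubmx (usubmx q.1)) (usubmx (usubmx q.2)) in
  dirac_form (f, e) q = pairing (w - J *m v + er - B *m ep) v'
    + pairing (fr - v) (dsubmx (usubmx q.2)) + pairing (B^T *m v + fp) (dsubmx q.2)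
    + pairing ed (dsubmx (usubmx (usubmx (usubmx q.1)))).
  case: q => f' e' [/= frE fpE wE edE].
  rewrite /dirac_form /= (pairing_col e) (pairing_col (usubmx e)).
  rewrite (pairing_col e') (pairing_col (usubmx e')).
  set s1 := pairing (usubmx (usubmx e)) _; set s2 := pairing (usubmx (usubmx e')) _.
  have : s1 + s2 = _ := pairing_hybrid _ _ _ _.
  rewrite -/v -/w -/ed -/er -/ep -/fr -/fp edE wE frE fpE pairing0l addr0.
  set v' := hybrid (usubmx (usubmx f')) _; set er' := dsubmx (usubmx e').
  set ep' := dsubmx e' => sE.
  rewrite !pairing_linear in sE *.
  move: sE; rewrite [pairing (J *m v') v]pairingC pairing_mulmx JT mulNmx pairingNl.
  rewrite [pairing (B *m ep') v]pairingC pairing_mulmx.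
  rewrite [pairing ep (B^T *m v')]pairing_mulmx trmxK.
  rewrite [pairing v er']pairingC [pairing fr er']pairingC [pairing fp ep']pairingC.
  by move=> /(canRL (addrK _)) ->; ring.
split=> [[frE fpE wE edE] q /DP /formE -> /=|pD].
  have -> : w - J *m v + er - B *m ep = w - (J *m v - er + B *m ep).
    by rewrite !opprD opprK !addrA.
  by rewrite wE frE fpE edE !subrr !pairing0l !addr0.
have relq v' er' ep' fd' : exists f' e', [/\ ph_relation f' e',
   hybrid (usubmx (usubmx f')) (usubmx (usubmx e')) = v',
   dsubmx (usubmx e') = er', dsubmx e' = ep' &
   dsubmx (usubmx (usubmx (usubmx f'))) = fd'].
  have [xf [xe [vE wE dE eE]]] := hybrid_onto v' (J *m v' - er' + B *m ep') fd'.
  exists (col_mx (col_mx xf v') (- (B^T *m v'))), (col_mx (col_mx xe er') ep').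
  by rewrite /ph_relation !(col_mxKu, col_mxKd) vE wE dE eE.
have key v' er' ep' fd' : pairing (w - J *m v + er - B *m ep) v'
    + pairing (fr - v) er' + pairing (B^T *m v + fp) ep' + pairing ed fd' = 0.
  have [f' [e' [rel <- <- <- <-]]] := relq v' er' ep' fd'.
  by rewrite -(formE (f', e') rel) pD//; exact/DP.
split.
- apply/eqP; rewrite -subr_eq0; apply/eqP/pairing_eq0 => t.
  by have := key 0 t 0 0; rewrite !pairing0r !addr0 add0r.
- apply/eqP; rewrite -addr_eq0 addrC; apply/eqP/pairing_eq0 => t.
  by have := key 0 0 t 0; rewrite !pairing0r !addr0 !add0r.
- apply/eqP; rewrite -subr_eq0 !opprD opprK !addrA; apply/eqP/pairing_eq0 => t.
  by have := key t 0 0 0; rewrite !pairing0r !addr0.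
- by apply/pairing_eq0 => t; have := key 0 0 0 t; rewrite !pairing0r !add0r.
Qed.

End Dirac.

(** * The energy *)

Section Gradient.
Context {R : realType} {k : nat}.
Variables (U : set 'cV[R]_k) (H : 'cV[R]_k -> R).
Hypotheses (oU : open U) (sH : smooth_on U H).

Lemma smooth_gradient : smooth_on U (gradient H).
Proof.
apply: smooth_mx => // i; under eq_fun do rewrite mxE.
exact: smooth_derive.
Qed.

Definition hessian (z : 'cV[R]_k) : 'M[R]_k :=
  \matrix_(i, j) 'D_(delta_mx j 0) ('D_(delta_mx i 0) H) z.

Lemma derive_gradient z w : U z -> 'D_w (gradient H) z = hessian z *m w.
Proof.
move=> Uz; have dG := smooth_differentiable smooth_gradient Uz.
apply/colP => i; rewrite -derive_coordE// mxE.
rewrite (_ : (fun y => _) = 'D_(delta_mx i 0) H); last first.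
  by apply/funext => y; rewrite mxE.
rewrite derive_coord; last by exact: (smooth_differentiable (smooth_derive _ sH)).
by apply: eq_bigr => j _; rewrite mxE mulrC.
Qed.

Lemma hessian_sym z : U z -> hessian z = (hessian z)^T.
Proof.
move=> Uz; apply/matrixP => i j; rewrite !mxE.
apply: (schwarz oU Uz).
- by move=> y Uy; exact: smooth_differentiable sH Uy.
- exact: smooth_differentiable (smooth_derive _ sH) Uz.
- exact: smooth_differentiable (smooth_derive _ sH) Uz.
Qed.

End Gradient.

Section Energy.
Context {R : realType} {n k : nat}.
Variables (E : 'M[R]_(n, k)) (U : set 'cV[R]_k) (H : 'cV[R]_k -> R).
Hypotheses (EtE : E^T *m E = 1%:M) (oU : open U) (sH : smooth_on U H).

(** The conormal bundle of the range of [E], shifted by the differential of [H]: over a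
    point [E z] the covectors are those whose restriction to the range of [E] is the
    gradient of [H] at [z]. *)
Definition conormal_energy : set ('cV[R]_n * 'cV[R]_n) :=
  [set p | [/\ U (E^T *m p.1), p.1 = E *m (E^T *m p.1) &
              E^T *m p.2 = gradient H (E^T *m p.1)]].

Lemma mulKEt m' (A : 'M[R]_(k, m')) : E^T *m (E *m A) = A.
Proof. by rewrite mulmxA EtE mul1mx. Qed.

Lemma open_energy_domain : open [set x : 'cV[R]_n | U (E^T *m x)].
Proof.
apply: (@open_comp _ _ (fun x : 'cV[R]_n => E^T *m x)) => // x _.
exact/linear_continuous/mulmx_linear_fun.
Qed.

Let C : set ('cV[R]_n * 'cV[R]_n) := [set p | U (E^T *m p.1)].
Let G (x : 'cV[R]_n) : 'cV[R]_n := E *m gradient H (E^T *m x).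

Let open_C : open C.
Proof.
apply: (@open_comp _ _ fst _ _ open_energy_domain) => p _.
exact: cvg_fst.
Qed.

Let smooth_G (V : normedModType R) (A : set V) (c : V -> 'cV[R]_n) : open A ->
  (forall x, A x -> U (E^T *m c x)) -> smooth_on A c -> smooth_on A (fun x => G (c x)).
Proof.
move=> oA AU sc; apply: smooth_mulmx => //.
apply: (smooth_comp oU oA AU (smooth_gradient oU sH)).
exact: smooth_mulmx.
Qed.

(** A single chart suffices: [(x, e) |-> (x, e - G x)]. *)
Lemma conormal_energy_submanifold : smooth_submanifold conormal_energy.
Proof.
move=> p [Up _ _].
have sG : smooth_on C (fun q => G q.1).
  by apply: smooth_G => //; apply: smooth_fst => //; exact: smooth_id.
have s1 : smooth_on C fst by apply: smooth_fst => //; exact: smooth_id.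
have s2 : smooth_on C snd by apply: smooth_snd => //; exact: smooth_id.
exists C, C, (fun q => (q.1, q.2 - G q.1)), (fun q => (q.1, q.2 + G q.1)).
exists [set q | q.1 = E *m (E^T *m q.1) /\ E^T *m q.2 = 0]; split.
- by [].
- split; apply: smooth_pair => //; apply: smoothD => //; exact: smoothN.
- by move=> q Cq; split=> //; apply: injective_projections; rewrite //= subrK.
- by move=> q Cq; split=> //; apply: injective_projections; rewrite //= addrK.
- split=> [|a v w [v1 v2] [w1 w2]|q Cq] /=; first by rewrite !mulmx0.
    by rewrite !mulmxDr -!scalemxAr -v1 -w1 v2 w2 scaler0 addr0.
  rewrite mulmxBr /G mulKEt; split=> [[_ q1 ->]|[q1 q2]]; first by rewrite subrr.
  by split=> //; apply/eqP; rewrite -subr_eq0 q2.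
Qed.

(** Differentiating the two equations of the energy along a curve gives the equations
    of [lagrangian_conormal] for its velocity, with [S] the Hessian.  Conversely, a
    solution of them is the velocity of the curve obtained by undoing the
    straightening chart along a line. *)
Lemma conormal_energy_lagrangian :
  lagrangian_submanifold [set x | U (E^T *m x)] conormal_energy.
Proof.
split=> [p []//||p]; first exact: conormal_energy_submanifold.
case: p => x e [/= Ux xE eE]; set z := E^T *m x in Ux xE eE *.
have [T TP lagT] := lagrangian_conormal EtE (hessian_sym oU sH Ux).
exists T; split=> // v; rewrite TP; split; last first.
  move=> [eps [c [eps0 sc cL c0 <-]]].
  have oI : open [set s : R | - eps < s < eps] by exact: open_sym_itv.
  have I0 : [set s : R | - eps < s < eps] 0 by rewrite /= oppr_lt0 eps0.
  have dc := smooth_differentiable sc I0.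
  have d1 : differentiable (fun s => (c s).1) 0.
    exact: (smooth_differentiable (smooth_fst oI sc) I0).
  have d2 : differentiable (fun s => (c s).2) 0.
    exact: (smooth_differentiable (smooth_snd oI sc) I0).
  rewrite derive1E.
  have -> : ('D_1 c 0).1 = 'D_1 (fun s => (c s).1) 0.
    by rewrite (@derive_lin _ _ _ _ fst)// => y; exact: cvg_fst.
  have -> : ('D_1 c 0).2 = 'D_1 (fun s => (c s).2) 0.
    by rewrite (@derive_lin _ _ _ _ snd)// => y; exact: cvg_snd.
  have dz : differentiable (fun s => E^T *m (c s).1) 0.
    exact: (smooth_differentiable (smooth_mulmx _ oI (smooth_fst oI sc)) I0).
  have c0U : U (E^T *m (c 0).1) by rewrite c0.
  split.
    rewrite -!derive_mulmx//; apply: near_eq_derive.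
    by apply: near_open oI I0 _ => s /cL[].
  rewrite -(derive_mulmx E^T (1 : R) d2) -(derive_mulmx E^T (1 : R) d1).
  rewrite (@near_eq_derive _ _ _ _ (fun s => gradient H (E^T *m (c s).1))); last first.
    by apply: near_open oI I0 _ => s /cL[].
  rewrite diff_compE//; last exact: smooth_differentiable (smooth_gradient oU sH) c0U.
  by rewrite (derive_gradient oU sH _ c0U) c0.
case: v => xi ep /= [xiE epE].
set zeta := E^T *m xi in xiE epE *.
have /nbhs_ballP[eps /= eps0 epsP] :
    \forall s \near (0 : R), U (z + s *: zeta).
  have cs : {for (0 : R), continuous (fun s : R => z + s *: zeta)}.
    exact: differentiable_continuous.
  by apply: cs; rewrite scale0r addr0; exact: open_nbhs_nbhs.
(* The first summand keeps the covector on the energy; the others stay in the kernel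
   of [E^T], and [E (hessian H z zeta)] compensates the velocity of the first. *)
pose c (s : R) := (x + s *: xi,
  G (x + s *: xi) + ((e - G x) + s *: (ep - E *m (hessian H z *m zeta)))).
exists eps, c.
have IU s : - eps < s < eps -> U (E^T *m (x + s *: xi)).
  move=> sI; rewrite mulmxDr -scalemxAr; apply: epsP.
  by rewrite /ball /= sub0r normrN ltr_norml.
have oI : open [set s : R | - eps < s < eps] by exact: open_sym_itv.
have I0 : [set s : R | - eps < s < eps] 0 by rewrite /= oppr_lt0 eps0.
have sx := smooth_line x xi oI.
have s2 := smooth_line (e - G x) (ep - E *m (hessian H z *m zeta)) oI.
have sG := smooth_G oI IU sx.
have sc : smooth_on [set s : R | - eps < s < eps] c.
  by apply: smooth_pair => //; exact: smoothD.
split=> //.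
- move=> s sI; split=> /=; first exact: IU.
    by rewrite !mulmxDr -!scalemxAr -xiE -xE.
  rewrite /G; move: (x + s *: xi) => w.
  rewrite mulmxDr mulmxDr -scalemxAr !mulmxBr !mulKEt eE epE.
  by rewrite !subrr scaler0 !addr0.
- by rewrite /c !scale0r !addr0 addrC subrK.
have dx := smooth_differentiable sx I0.
have dG := smooth_differentiable sG I0.
have d2 := smooth_differentiable s2 I0.
have dc := smooth_differentiable sc I0.
have dEx := smooth_differentiable (smooth_mulmx E^T oI sx) I0.
rewrite derive1E; apply: injective_projections.
  rewrite -(@derive_lin _ _ _ _ fst)//; first by rewrite derive_line.
  by move=> y; exact: cvg_fst.
rewrite -(@derive_lin _ _ _ _ snd)//; last by move=> y; exact: cvg_snd.
have U0 : U (E^T *m (x + 0 *: xi)) by rewrite scale0r addr0.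
have dg := smooth_differentiable (smooth_gradient oU sH) U0.
rewrite /c/= deriveD; [|exact: diff_derivable..].
rewrite derive_line /G derive_mulmx; last first.
  exact: (@differentiable_comp _ _ _ _ _ (gradient H) _ dEx dg).
rewrite diff_compE// (derive_gradient oU sH)// derive_mulmx// derive_line scale0r addr0.
by rewrite addrC subrK.
Qed.

End Energy.

(** * The port-Hamiltonian system *)

Section Embedding.
Context {R : realType} {n1 n2 n3 m : nat}.
Local Notation N := (n1 + n2 + n3)%N.
Local Notation n := (n1 + n2 + 1 + n3)%N.

(** The inclusion of the [z]-space in the state space.  Having it as a matrix makes its
    adjoint, the projection, available as [E^T]. *)
Definition state_emb : 'M[R]_(n, n1 + n2) := col_mx (col_mx 1%:M 0) 0.
Local Notation E := state_emb.

Lemma state_emb_tr (x : 'cV[R]_n) : E^T *m x = usubmx (usubmx x).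
Proof.
rewrite -{1}[x]vsubmxK -{1}[usubmx x]vsubmxK !tr_col_mx !mul_row_col trmx1.
by rewrite !trmx0 !mul0mx mul1mx !addr0.
Qed.

Lemma state_embE (z : 'cV[R]_(n1 + n2)) : E *m z = col_mx (col_mx z 0) 0.
Proof. by rewrite !mul_col_mx mul1mx !mul0mx. Qed.

Lemma state_embK : E^T *m E = 1%:M.
Proof. by rewrite !tr_col_mx !mul_row_col trmx1 !trmx0 !mul0mx mul1mx !addr0. Qed.

Variables (J Rm : 'M[R]_N) (B : 'M[R]_(N, m)).

(** The system at one instant, once the energy has fixed the state to [E z]. *)
Lemma ph_relation_emb (zdot : 'cV[R]_(n1 + n2)) (e : 'cV[R]_n) (fr er : 'cV[R]_N)
    (u y : 'cV[R]_m) :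
  let v := col_mx (col_mx (usubmx zdot) (dsubmx (E^T *m e))) (dsubmx e) in
  ph_relation J B (col_mx (col_mx (E *m zdot) fr) (- y)) (col_mx (col_mx e er) u) /\
    er = Rm *m fr <->
  [/\ fr = v, er = Rm *m fr, dsubmx (usubmx e) = 0,
      col_mx (col_mx (usubmx (E^T *m e)) (dsubmx zdot)) 0 = (J - Rm) *m v + B *m u &
      y = B^T *m v].
Proof.
rewrite /ph_relation /hybrid state_embE state_emb_tr !(col_mxKu, col_mxKd) mulmxBl.
split=> [[[-> yE eqE edE] erE]|[-> -> edE eqE ->]]; last by split.
by rewrite -erE; split=> //; exact: oppr_inj.
Qed.

End Embedding.

Theorem proposition4p1 (R : realType) (n1 n2 n3 m : nat)
    (U : set 'cV[R]_(n1 + n2)) (H : 'cV[R]_(n1 + n2) -> R)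
    (J Rm : 'M[R]_(n1 + n2 + n3)) (B : 'M[R]_(n1 + n2 + n3, m))
    (Uopen : open U) (Une : U !=set0) (Hsmooth : smooth_on U H)
    (Jskew : J + J^T = 0) (Rsym : Rm = Rm^T)
    (Rpsd : forall v : 'cV[R]_(n1 + n2 + n3), 0 <= (v^T *m Rm *m v) 0 0) :
  exists (k r : nat) (S : ph_system R (k + n3) r m)
         (sz : 'I_(n1 + n2) -> 'I_(k + n3)),
    [/\ implicit_energy S,
        equivalent_to_ph (given_system U H J Rm B) S sz
          (@covector_index k n3 r) &
        unconstrained_covector S].
Proof.
pose E : 'M[R]_(n1 + n2 + 1 + n3, n1 + n2) := state_emb.
have EtE : E^T *m E = 1%:M by exact: state_embK.
have [D DP diracD] := dirac_ph_relation B Jskew.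
have [L LP lagL] : exists2 L : {vspace 'cV[R]_(n1 + n2 + n3) * 'cV[R]_(n1 + n2 + n3)},
    forall p, p \in L <-> p.2 = Rm *m p.1 & lagrangian_subspace L.
  have I1 : (1%:M : 'M[R]_(n1 + n2 + n3))^T *m 1%:M = 1%:M by rewrite trmx1 mul1mx.
  have [L LP lagL] := lagrangian_conormal I1 Rsym; exists L => // p.
  by rewrite LP trmx1 !mul1mx; split=> [[]|].
have L_ge0 : nonnegative_subspace L.
  by move=> p /LP ->; rewrite pairingC pairingE mulmxA.
pose S := PHSystem (@open_energy_domain _ _ _ E _ Uopen) diracD lagL L_ge0
  (conormal_energy_lagrangian EtE Uopen Hsmooth).
exists (n1 + n2 + 1)%N, (n1 + n2 + n3)%N, S, (lshift n3 \o lshift 1); split.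
- (* Over [E z0] the covectors [e0] and [e1] are both allowed, as they differ on the
     additional scalar coordinate only. *)
  move=> [K [_ /= KE]]; have [z0 Uz0] := Une.
  have energyE e : conormal_energy E U H (E *m z0, e) <-> E^T *m e = gradient H z0.
    by rewrite /conormal_energy /= (mulKEt EtE); split=> [[]|].
  pose e0 : 'cV[R]_(n1 + n2 + 1 + n3) := E *m gradient H z0.
  pose e1 := e0 + col_mx (col_mx 0 1) 0.
  have : conormal_energy E U H (E *m z0, e0) by apply/energyE; rewrite (mulKEt EtE).
  have : conormal_energy E U H (E *m z0, e1).
    apply/energyE; rewrite mulmxDr (mulKEt EtE)// [X in _ + X]state_emb_tr.
    by rewrite !col_mxKu addr0.
  rewrite KE => -[_ /= e1E] [_ /= e0E].
  have : (col_mx (col_mx 0 1) 0 : 'cV[R]_(n1 + n2 + 1 + n3)) = 0.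
    by apply: (addrI e0); rewrite addr0 -/e1 e1E e0E.
  move=> /(congr1 (fun x : 'cV[R]_(n1 + n2 + 1 + n3) => dsubmx (usubmx x) 0 0)) /eqP.
  by rewrite /= col_mxKu col_mxKd linear0 !mxE eqxx oner_eq0.
- split.
  + by move=> i j /lshift_inj/lshift_inj.
  + by move=> i j /lshift_inj/rshift_inj.
  move=> t0 t1 z z3 u y; have oI : open (open_interval t0 t1) by exact: open_open_interval.
  set I := open_interval t0 t1 in oI *.
  have sz (x : 'cV[R]_(n1 + n2 + 1 + n3)) :
      rowsub (lshift n3 \o lshift 1) x = E^T *m x.
    by rewrite state_emb_tr; apply/colP => i; rewrite !mxE.
  have sw (e : 'cV[R]_(n1 + n2 + 1 + n3)) (w : 'cV[R]_((n1 + n2 + n3) + (n1 + n2 + n3))) :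
      rowsub (@covector_index (n1 + n2 + 1) n3 (n1 + n2 + n3)) (col_mx e w) = dsubmx e.
    by apply/colP => i; rewrite !mxE (unsplitK (inl _)); congr (e _ _).
  have derz t : differentiable z t ->
      derive1 (fun s => usubmx (z s)) t = usubmx (derive1 z t) /\
      derive1 (fun s => dsubmx (z s)) t = dsubmx (derive1 z t).
    by move=> dz; rewrite !derive1E derive_usubmx// derive_dsubmx.
  split.
    move=> [[sz' sz3] [su sy] sys].
    pose v t := col_mx (col_mx (usubmx (derive1 z t)) (dsubmx (gradient H (z t)))) (z3 t).
    (* The Dirac structure requires effort 0 on the additional coordinate. *)
    exists (fun t => E *m z t), (fun t => col_mx (col_mx (gradient H (z t)) 0) (z3 t)).
    exists v, (fun t => Rm *m v t).
    have UI t : I t -> U (z t) by move=> /sys[].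
    have sg : smooth_on I (fun t => gradient H (z t)).
      exact: (smooth_comp Uopen oI UI (smooth_gradient Uopen Hsmooth)).
    have sdz : smooth_on I (derive1 z).
      have -> : derive1 z = 'D_1 z by apply/funext => t; exact: derive1E.
      exact: smooth_derive.
    have sv : smooth_on I v.
      apply: smooth_col => //; apply: smooth_col => //.
        exact: smooth_usubmx.
      exact: smooth_dsubmx.
    split; last first.
      by move=> t It; rewrite sz sw col_mxKd (mulKEt EtE).
    split=> //.
      split=> //; [exact: smooth_mulmx| |exact: smooth_mulmx].
      by do 2!apply: smooth_col => //; exact: smooth_cst.
    move=> t It; have [Uz eqz yE] := sys _ It.
    have dz := smooth_differentiable sz' It.
    have [d1 d2] := derz t dz.
    rewrite d1 d2 in eqz yE.
    have eE : E^T *m col_mx (col_mx (gradient H (z t)) 0) (z3 t) = gradient H (z t).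
      by rewrite state_emb_tr !col_mxKu.
    have [rel er] : ph_relation J B (col_mx (col_mx (E *m derive1 z t) (v t)) (- y t))
        (col_mx (col_mx (col_mx (col_mx (gradient H (z t)) 0) (z3 t)) (Rm *m v t)) (u t)) /\
        Rm *m v t = Rm *m v t.
      by apply/ph_relation_emb; rewrite eE col_mxKu !col_mxKd.
    split=> /=; first by rewrite (mulKEt EtE).
    + have xdot : derive1 (fun s => E *m z s) t = E *m derive1 z t.
        by rewrite !derive1E derive_mulmx.
      by apply/DP; rewrite xdot; exact: rel.
    + exact/LP.
    + by split; rewrite /= (mulKEt EtE).
  move=> [x [e [fr [er [[[sx se sfr ser] [su sy] sol] zw]]]]].
  have zE t : I t -> z t = E^T *m x t by move=> /zw[-> _]; rewrite sz.
  have z3E t : I t -> z3 t = dsubmx (e t) by move=> /zw[_ ->]; rewrite sw.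
  have sz' : smooth_on I z.
    by apply: smooth_ext (smooth_mulmx E^T oI sx) => // t It; rewrite zE.
  split=> //.
    by split=> //; apply: smooth_ext (smooth_dsubmx oI se) => // t It; rewrite z3E.
  move=> t It; have dz := smooth_differentiable sz' It.
  have [d1 d2] := derz t dz; rewrite d1 d2.
  have [_ /DP /= rel /LP /= erE [/= Ux xE eE]] := sol t It.
  (* The energy keeps [x] in the range of [E], hence also its velocity. *)
  have xdot : derive1 x t = E *m derive1 z t.
    rewrite !derive1E -derive_mulmx//; apply: near_eq_derive.
    apply: near_open oI It _ => s Is; have [_ _ _ [_ /= -> _]] := sol s Is.
    by rewrite zE// (mulKEt EtE).
  rewrite xdot in rel.
  have [_ _ _ eqz yE] := (ph_relation_emb J Rm B _ _ _ _ _ _).1 (conj rel erE).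
  rewrite -zE// in eE Ux.
  by rewrite -eE z3E.
- move=> x eY zeta zeta' [/= Ux xE eE]; split=> //=.
  by rewrite -eE !state_emb_tr !col_mxKu.
Qed.
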